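(* Let $G$ be a finite simple $2$-connected graph and let $C$ be a cycle of odd length in $G$. Then every edge $e \in E(G) \setminus E(C)$ is contained in a cycle of even length in $G$.
   Context: Graphs are finite, simple (no loops, no multiple edges). A graph is $2$-connected if it has more than $2$ vertices and remains connected whenever fewer than $2$ vertices are removed. The length of a cycle is its number of edges; a cycle is odd (even) if its length is odd (even). *)

(* Defs.v *)
From mathcomp Require Import all_boot.

Set Implicit Arguments.
Unset Strict Implicit.
Unset Printing Implicit Defensive.

Record sgraph := SGraph {
  vertex :> finType;
  adj : rel vertex;
  adj_sym : symmetric adj;
  adj_irrefl : irreflexive adj }.

Definition edges (G : sgraph) : {set {set G}} :=
  [set [set x; y] | x in G, y in G & adj x y].

(* Connectedness of the subgraph induced by S: the connecting walks must stay
   inside S. *)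
Definition connected_on (G : sgraph) (S : {set G}) : Prop :=
  {in S &, forall x y,
    connect [rel u v | [&& u \in S, v \in S & adj u v]] x y}.

Definition k_connected (k : nat) (G : sgraph) : Prop :=
  k < #|G| /\ forall X : {set G}, #|X| < k -> connected_on (~: X).

(* A cycle is given by the cyclic sequence of its vertices. MathComp's ucycle
   also accepts sequences of fewer than three vertices (the empty sequence, and
   x, y traversing one edge back and forth), hence the bound on the size. *)
Definition graph_cycle (G : sgraph) (c : seq G) : Prop :=
  2 < size c /\ ucycle (@adj G) c.

Definition cycle_edges (G : sgraph) (c : seq G) : {set {set G}} :=
  [set [set x; next c x] | x in c].

Definition cycle_length (G : sgraph) (c : seq G) : nat := #|cycle_edges c|.

(* Main.v *)
Require Import Defs.
From mathcomp Require Import all_boot.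

(** Menger's theorem for two paths is propagated along a walk that starts with
    an edge of [C] and ends with [e]: any two consecutive vertices of the walk
    are joined to [C] by disjoint paths. Together with [e], the two paths
    obtained for the ends of [e] form a path between two vertices of [C], and
    the two arcs of the odd cycle [C] between these have different parities, so
    one of them closes this path to an even cycle. *)

Set Implicit Arguments.
Unset Strict Implicit.
Unset Printing Implicit Defensive.

(** * Pairs of disjoint paths leading into a set of vertices *)

Section Paths.
Variables (T : eqType) (e : rel T).

Lemma path_first_hit (S : pred T) x p :
  path e x p -> has S (x :: p) ->
  exists q, [/\ path e x q, S (last x q), {subset x :: q <= x :: p}
    & {in x :: q, forall z, S z -> z = last x q}].
Proof.
elim: p x => [|y p IHp] x /=.
  by rewrite orbF => _ Sx; exists [::]; split=> //= z; rewrite inE => /eqP.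
case/andP=> exy pathp; case Sx: (S x) => /=.
  exists [::]; split=> // z; first by rewrite !inE => ->.
  by rewrite inE => /eqP.
case/(IHp y pathp)=> q [pathq Slast sub_q qP]; exists (y :: q); split=> //=.
- by rewrite exy.
- move=> z; rewrite inE => /orP[/eqP->|/sub_q zp]; first exact: mem_head.
  by rewrite inE zp orbT.
- by move=> z /predU1P[->|/qP//]; rewrite Sx.
Qed.

(** The last clause is what keeps [v] off the new path for [w] in [disjointly_linked_step] when that
    path follows [B]. *)
Lemma path_suffix x p z :
  path e x p -> z \in x :: p ->
  exists q, [/\ path e z q, last z q = last x p, {subset z :: q <= x :: p}
    & uniq (x :: p) -> z != x -> x \notin z :: q].
Proof.
move=> pathp /predU1P[->|zp].
  by exists p; split=> //; rewrite eqxx.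
case/splitPr: zp pathp => p1 p2.
rewrite cat_path /= => /and3P[_ _ pathp2]; exists p2; split=> //.
- by rewrite last_cat.
- by move=> t t_in; rewrite inE mem_cat t_in !orbT.
- by rewrite /= mem_cat negb_or => /andP[/andP[_ ->]].
Qed.

(** The paths may repeat vertices and may meet [S] before their ends, so that propagation has less
    to maintain; [disjointly_linked_minimal] cleans them up afterwards. *)
Definition disjointly_linked (S : pred T) x y :=
  exists A B, [/\ path e x A, path e y B, S (last x A), S (last y B)
    & ~~ has (mem (x :: A)) (y :: B)].

(* The walk [r] is followed up to its first vertex on one of the two given paths
   [A] (from [u]) and [B] (from [v]), and then that path. In the first case [B]
   serves [v]; in the second one, [A] prolonged by the edge from [v] to [u]. *)
Lemma disjointly_linked_step S u v w r :
  symmetric e -> disjointly_linked S u v -> e u v ->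
  path e w r -> last w r = u -> v \notin w :: r ->
  disjointly_linked S v w.
Proof.
move=> e_sym [A [B0 [pathA pathB0 SA SB0 disj0]]] euv pathr last_r vNr.
(* Without repetitions in [v :: B], following [B] from any later vertex on avoids [v]. *)
have [B [pathB uniqB SB disj]] : exists B, [/\ path e v B, uniq (v :: B),
    S (last v B) & ~~ has (mem (u :: A)) (v :: B)].
  move: SB0; case/shortenP: pathB0 => B pathB uniqB sub_B SB; exists B.
  split=> //; apply: contra disj0 => /hasP[z zB zA]; apply/hasP; exists z=> //.
  by move: zB; rewrite !inE => /orP[->//|/sub_B->]; rewrite orbT.
(* The walk [r] ends in [u], so it does meet one of the two paths. *)
have [|q [pathq hit_q sub_q qP]] :=
    @path_first_hit (mem ((u :: A) ++ v :: B)) w r pathr.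
  apply/hasP; exists u; last by rewrite inE mem_head.
  by rewrite -last_r mem_last.
have vNq : v \notin w :: q by apply: contra vNr; apply: sub_q.
have {}qP z : z \in w :: q -> (z \in u :: A) || (z \in v :: B) ->
    z = last w q by rewrite -mem_cat => zq /(qP z zq).
have ABP z : z \in u :: A -> z \in v :: B -> False.
  by move=> zA zB; case/hasP: disj; exists z.
move: (hit_q : last w q \in (u :: A) ++ v :: B); rewrite mem_cat => /orP[hitA|hitB].
- have [s [paths last_s sub_s _]] := path_suffix pathA hitA.
  exists B, (q ++ s); split=> //.
  + by rewrite cat_path pathq.
  + by rewrite last_cat last_s.
  apply/hasP=> -[z]; rewrite -cat_cons mem_cat => /orP[zq|zs] zB.
    have zE : z = last w q by apply: qP => //; apply/orP; right.
    by apply: (ABP z) => //; rewrite zE.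
  by apply: (ABP z) => //; apply: sub_s; rewrite inE zs orbT.
- have [s [paths last_s sub_s vNs]] := path_suffix pathB hitB.
  have {}vNs : v \notin last w q :: s.
    by apply: vNs => //; apply: contraNneq vNq => <-; apply: mem_last.
  exists (u :: A), (q ++ s); split=> //.
  + by rewrite /= e_sym euv.
  + by rewrite cat_path pathq.
  + by rewrite last_cat last_s.
  apply/hasP=> -[z]; rewrite -cat_cons mem_cat => zqs zA.
  (* The prolonged path also contains [v], which [q] misses because [r] does, and [s] misses because
     [B] is simple. *)
  have {zA} /predU1P[zv|zA] : z \in v :: u :: A := zA.
    move: zqs; rewrite zv (negPf vNq) /= => vs.
    by move: vNs; rewrite inE vs orbT.
  case/orP: zqs => [zq|zs].
    have zE : z = last w q by apply: qP => //; apply/orP; left.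
    by apply: (ABP z) => //; rewrite zE.
  by apply: (ABP z) => //; apply: sub_s; rewrite inE zs orbT.
Qed.

(** Cutting each path at its first vertex in [S] and then removing repetitions only discards
    vertices, so disjointness survives. *)
Lemma disjointly_linked_minimal S x y :
  disjointly_linked S x y ->
  exists A B, [/\ path e x A, path e y B, S (last x A) & S (last y B)] /\
    [/\ uniq ((x :: A) ++ y :: B),
      {in x :: A, forall z, S z -> z = last x A}
      & {in y :: B, forall z, S z -> z = last y B}].
Proof.
have minimal z p : path e z p -> S (last z p) -> exists q, [/\ path e z q,
    S (last z q), uniq (z :: q), {subset z :: q <= z :: p}
    & {in z :: q, forall t, S t -> t = last z q}].
  move=> pathp Sp; have [|q [pathq Sq sub_q qP]] := @path_first_hit S z p pathp.
    by apply/hasP; exists (last z p) => //; apply: mem_last.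
  move: Sq qP; case/shortenP: pathq => q' pathq' uniqq' sub_q' Sq' qP.
  have {}sub_q' : {subset z :: q' <= z :: q}.
    by move=> t; rewrite !inE => /orP[->//|/sub_q'->]; rewrite orbT.
  exists q'; split=> // t /sub_q'; [exact: sub_q | exact: qP].
case=> A [B [pathA pathB SA SB disj]].
have [A' [pathA' SA' uniqA' sub_A' A'P]] := minimal _ _ pathA SA.
have [B' [pathB' SB' uniqB' sub_B' B'P]] := minimal _ _ pathB SB.
exists A', B'; split=> //; split=> //; rewrite cat_uniq uniqA' uniqB' andbT.
apply: contra disj => /hasP[z /sub_B' zB /sub_A' zA].
by apply/hasP; exists z.
Qed.

End Paths.

(** * Edges and arcs of a cycle *)

Section Cycles.
Variable T : finType.
Implicit Types (c s : seq T) (a b x : T).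

Lemma next_next_neq c x :
  uniq c -> 2 < size c -> x \in c -> next c (next c x) != x.
Proof.
move=> uniqc sizec xc; have [i s def_c] := rot_to xc.
rewrite -!(next_rot i uniqc) def_c.
move: uniqc sizec; rewrite -(rot_uniq i) -(size_rot i) def_c.
case: s {def_c} => [|y [|z s]] //=; rewrite !inE !negb_or eqxx.
by case/andP=> /and3P[xy xz _] _ _; rewrite [y == x]eq_sym (negPf xy) eqxx eq_sym.
Qed.

(** Two vertices giving the same edge would be successors of each other, which [next_next_neq]
    excludes. *)
Lemma card_next_edges c : uniq c -> 2 < size c ->
  #|[set [set x; next c x] | x in c]| = size c.
Proof.
move=> uniqc sizec; rewrite card_in_imset ?(card_uniqP uniqc)// => x y xc yc.
move=> eq_xy; apply/eqP; apply/negPn/negP => neq_xy.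
have : x \in [set y; next c y] by rewrite -eq_xy set21.
have : y \in [set x; next c x] by rewrite eq_xy set21.
rewrite !inE (negPf neq_xy) eq_sym (negPf neq_xy) /= => /eqP yE /eqP xE.
by have := next_next_neq uniqc sizec xc; rewrite -yE -xE eqxx.
Qed.

Lemma next_last x s : uniq (x :: s) -> next (x :: s) (last x s) = x.
Proof.
(* Rotating by [size s] brings the last vertex to the front, where [next] computes. *)
rewrite lastI => uniqs; rewrite -(next_rot (size s)) //.
rewrite -cats1 -{1}(size_belast x s) rot_size_cat /=.
by case: s {uniqs} => [|y s] /=; rewrite !eqxx.
Qed.

(* The two arcs between [a] and [b] have different parities, hence either
   parity can be prescribed. *)
Lemma odd_cycle_arc (e : rel T) c a b (odd_s : bool) :
  symmetric e -> cycle e c -> uniq c -> odd (size c) ->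
  a \in c -> b \in c -> a != b ->
  exists s, [/\ path e a (rcons s b), uniq (a :: rcons s b),
    {subset s <= c}, odd (size s) = odd_s
    & s = [::] -> [set a; b] \in [set [set x; next c x] | x in c]].
Proof.
move=> e_sym cyclec uniqc oddc ac bc neq_ab.
have [i s def_c] := rot_to ac.
have {}bc : b \in s.
  by move: bc; rewrite -(mem_rot i) def_c inE eq_sym (negPf neq_ab).
have sub_c z : z \in s -> z \in c.
  by rewrite -(mem_rot i c) def_c inE orbC => ->.
have nextE := next_rot i uniqc.
move: cyclec (uniqc) oddc sub_c nextE.
rewrite -(rot_cycle i) -(rot_uniq i) -(size_rot i) def_c.
(* The rotated cycle reads [a], [s1], [b], [s2]. The arcs from [a] to [b] have interiors [s1] and
   [rev s2], whose sizes add up to the odd number [size c - 2]. *)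
case/splitPr: (bc) def_c => s1 s2 def_c; rewrite /= rcons_cat cat_path /= => /and3P[].
move=> path1 e1 path2; rewrite mem_cat inE !negb_or cat_uniq size_cat /=.
case/and3P=> /and3P[a1 _ a2] uniq1 /and3P[]; rewrite negb_or => /andP[b1 disj].
move=> b2 uniq2 parity sub_c nextE.
have [odd1|odd1] := eqVneq (odd (size s1)) odd_s.
  exists s1; split=> //.
  - by rewrite rcons_path path1.
  - by rewrite /= mem_rcons inE negb_or neq_ab a1 rcons_uniq b1.
  - by move=> z z1; apply: sub_c; rewrite mem_cat z1.
  - move=> s10; apply/imsetP; exists a => //.
    by rewrite -nextE s10 /= eqxx.
exists (rev s2); split.
- have := rev_path e b (rcons s2 a).
  rewrite last_rcons belast_rcons rev_cons => ->.
  by rewrite (eq_path (e' := e)).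
- by rewrite -rev_cons /= mem_rev inE negb_or neq_ab a2 rev_uniq /= b2.
- by move=> z; rewrite mem_rev => z2; apply: sub_c; rewrite mem_cat inE z2 !orbT.
- rewrite size_rev; move: parity odd1; rewrite oddD /=.
  by case: (odd (size s1)); case: (odd (size s2)); case: odd_s.
(* If [s2] is empty, [b] is last in the rotated cycle and its successor is [a]. *)
- move/(congr1 rev); rewrite revK => s20; rewrite {}s20 in nextE def_c uniqc.
  apply/imsetP; exists b; first by apply: sub_c; rewrite mem_cat mem_head orbT.
  rewrite -nextE setUC; congr [set b; _].
  have := @next_last a (rcons s1 b); rewrite last_rcons -cats1 => -> //.
  by rewrite -def_c rot_uniq.
Qed.

End Cycles.

(** * Even cycles in 2-connected graphs *)

Section Graph.
Variable G : sgraph.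
Implicit Types (S : pred G) (c : seq G) (x y : G).

Lemma cycle_length_size c : graph_cycle c -> cycle_length c = size c.
Proof. by case=> sizec /andP[_ uniqc]; apply: card_next_edges. Qed.

(** Deleting [v] leaves a connected graph, hence a walk from [w] to [u] that misses [v], as
    [disjointly_linked_step] requires. *)
Lemma two_connected_step S u v w :
  k_connected 2 G -> adj u v -> adj v w ->
  disjointly_linked (@adj G) S u v -> disjointly_linked (@adj G) S v w.
Proof.
move=> [_ conn] uv vw linked.
have wv : w \in ~: [set v].
  by rewrite !inE; apply: contraTneq vw => ->; rewrite adj_irrefl.
have uv' : u \in ~: [set v].
  by rewrite !inE; apply: contraTneq uv => ->; rewrite adj_irrefl.
have [|r pathr lastr] := connectP (conn [set v] _ w u wv uv').
  by rewrite cards1.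
apply: (disjointly_linked_step (@adj_sym G) linked uv _ (esym lastr)).
  by apply: sub_path pathr => s t /and3P[].
apply/negP=> /predU1P[vw'|vr]; first by rewrite vw' !inE eqxx in wv.
case/splitPr: vr pathr {lastr} => p1 p2.
by rewrite cat_path /= !inE eqxx andbF /= andbF.
Qed.

(** The vertices [u] and [v] are linked to [S] by empty paths; the link is carried edge by edge
    along a walk from [v] to [x], and finally across the edge to [y]. *)
Lemma two_connected_linked S u v x y :
  k_connected 2 G -> S u -> S v -> adj u v -> adj x y ->
  disjointly_linked (@adj G) S x y.
Proof.
move=> conn Su Sv uv xy.
have walk p s t : path (@adj G) t p -> adj s t ->
    disjointly_linked (@adj G) S s t -> adj (last t p) y ->
    disjointly_linked (@adj G) S (last t p) y.
  elim: p s t => [|z p IHp] s t /=.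
    by move=> _ st linked ty; apply: two_connected_step linked.
  case/andP=> tz pathp st linked; apply: IHp pathp (tz) _.
  exact: two_connected_step st tz linked.
have inT (z : G) : z \in ~: (set0 : {set G}) by rewrite !inE.
have [|p pathp xE] := connectP (proj2 conn set0 _ v x (inT v) (inT x)).
  by rewrite cards0.
rewrite xE in xy *; apply: (walk p u) => //.
  by apply: sub_path pathp => s t /and3P[].
exists [::], [::]; split=> //=; rewrite orbF inE.
by apply: contraTneq uv => ->; rewrite adj_irrefl.
Qed.

(** The cycle runs from [x] along [A] into [c], along an arc of [c], and back along [B] to [y]. *)
Lemma close_path_in_cycle c x y A B :
  graph_cycle c -> odd (size c) -> adj x y ->
  [set x; y] \notin cycle_edges c ->
  path (@adj G) x A -> path (@adj G) y B -> last x A \in c -> last y B \in c ->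
  uniq ((x :: A) ++ y :: B) ->
  {in x :: A, forall z, z \in c -> z = last x A} ->
  {in y :: B, forall z, z \in c -> z = last y B} ->
  exists2 s, graph_cycle s & ~~ odd (size s) /\ [set x; y] \in cycle_edges s.
Proof.
case=> sizec /andP[cyclec uniqc] oddc xy xyNc pathA pathB Ac Bc uniqAB A_c B_c.
have neq_AB : last x A != last y B.
  apply: contraTneq uniqAB => eqAB; rewrite cat_uniq; apply/nandP; right.
  apply/nandP; left; rewrite negbK; apply/hasP.
  exists (last y B); first exact: mem_last.
  by rewrite -eqAB; apply: mem_last.
(* Besides [s], the cycle has [size A + size B + 2] vertices, so this parity makes its length
   even. *)
have [s [paths uniqs sub_s odds s0]] :=
  odd_cycle_arc (odd (size A + size B)) (@adj_sym G) cyclec uniqc oddc Ac Bc neq_AB.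
move: uniqs; rewrite /= mem_rcons inE negb_or rcons_uniq.
case/andP=> /andP[_ As] /andP[Bs uniqs].
pose D := (x :: A) ++ s ++ rev (y :: B).
have sizeD : size D = (size A + size B + size s).+2.
  by rewrite !size_cat size_rev /= !addnS addSn (addnC (size s)) addnA.
have uniqD : uniq D.
  have permD : perm_eq D (((x :: A) ++ y :: B) ++ s).
    by rewrite -catA perm_cat2l perm_catC perm_cat2r perm_rev.
  rewrite (perm_uniq permD) cat_uniq uniqAB uniqs andbT.
  (* A common vertex lies on [c], hence is the end of its path, but the ends of the arc are not in
     its interior. *)
  apply/hasP=> -[z zs]; rewrite mem_cat => /orP[zA|zB].
    by move: As; rewrite -(A_c z zA (sub_s z zs)) zs.
  by move: Bs; rewrite -(B_c z zB (sub_s z zs)) zs.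
have gD : graph_cycle D.
  split.
    (* If [A], [B] and [s] were all empty, [s0] would make [[set x; y]] an edge of [c]. *)
    rewrite sizeD !ltnS lt0n !addn_eq0 !size_eq0.
    apply: contra xyNc => /andP[/andP[/eqP A0 /eqP B0] /eqP/s0].
    by rewrite A0 B0.
  apply/andP; split=> //; rewrite /D [y :: B]lastI rev_rcons -cat_rcons /=.
  rewrite rcons_path !cat_path pathA last_rcons paths rev_path !last_cat /=.
  rewrite last_rcons (eq_path (e' := @adj G)) ?pathB; last by move=> s' t; rewrite adj_sym.
  have -> : last (last y B) (rev (belast y B)) = y; last by rewrite adj_sym.
  by rewrite -[LHS](last_cons y) -rev_rcons -lastI rev_cons last_rcons.
exists D => //; split; first by rewrite sizeD /= !negbK oddD odds addbb.
(* The edge from [x] to [y] closes [D], from its last vertex [y] to its first vertex [x]. *)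
apply/imsetP; exists y; first by rewrite !mem_cat mem_rev mem_head !orbT.
rewrite setUC; congr [set y; _].
have := next_last uniqD; rewrite !last_cat rev_cons last_rcons => {1}<-.
by rewrite /D rev_cons.
Qed.

End Graph.

Theorem theorem1 (G : sgraph) (C : seq G) :
  k_connected 2 G -> graph_cycle C -> odd (cycle_length C) ->
  forall e : {set G}, e \in edges G :\: cycle_edges C ->
  exists D : seq G,
    [/\ graph_cycle D, ~~ odd (cycle_length D) & e \in cycle_edges D].
Proof.
move=> conn cycC oddC e /setDP[/imset2P[x y _]]; rewrite !inE /= => xy -> eNC.
rewrite cycle_length_size // in oddC.
(* The first edge of [C] starts the propagation. *)
have [u [v [uC vC uv]]] : exists u v, [/\ u \in C, v \in C & adj u v].
  case: cycC => sizeC /andP[cycleC _]; case: C sizeC cycleC {oddC eNC} => [|u [|v s]] //= _.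
  by case/andP=> uv _; exists u, v; rewrite !inE !eqxx orbT.
have [A [B [[pathA pathB CA CB] [uniqAB AC BC]]]] :=
  disjointly_linked_minimal (two_connected_linked (S := mem C) conn uC vC uv xy).
have [D cycD [evenD eD]] :=
  close_path_in_cycle cycC oddC xy eNC pathA pathB CA CB uniqAB AC BC.
by exists D; rewrite cycle_length_size.
Qed.
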